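(* Let $p,q$ be integers with $p\neq 0$, $q\neq 0$ and $\Delta=p^2-4q\neq 0$. Let $k\geq 2$ and $m\geq 1$ be integers. Then: (i) $\displaystyle\sum_{t=0}^{k-1}\binom{k-1}{t}(-p)^{-t}U_{mk+t}^{(k)}=\left(\frac{q}{p}\right)^{k-1}U_{m}\,U_{(m-1)(k-1)}^{(k-1)}$; (ii) $\displaystyle\sum_{t=0}^{k-1}\binom{k-1}{t}\left(\frac{-p}{q}\right)^{t}U_{mk+t}^{(k)}=(-q)^{1-k}U_{m}\,U_{(m+2)(k-1)}^{(k-1)}$; (iii) if moreover $U_{m-1}\neq 0$, then $\displaystyle\sum_{t=0}^{k-1}p^{-t}U_{mk+t}^{(k)}=\left(-\frac{p}{q}\right)p^{-k}\left(\frac{U_{m}}{U_{m-1}}\right)\left(U_{(m+1)k}^{(k)}-p^{k}U_{mk}^{(k)}\right)$.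
   Context: For integers $p,q$, the sequence $(U_n)_{n\geq 0}$ is defined by $U_0=0$, $U_1=1$, $U_n=pU_{n-1}-qU_{n-2}$ for $n\geq 2$. Let $\alpha=\frac{p+\sqrt{\Delta}}{2}$, $\beta=\frac{p-\sqrt{\Delta}}{2}$ with $\Delta=p^2-4q$; when $\Delta\neq0$ one has $U_n=\frac{\alpha^n-\beta^n}{\alpha-\beta}$. For an integer $k\geq 1$ and an integer $n\geq 0$, write uniquely $n=mk+r$ with $m\geq 0$ and $0\leq r<k$, and define the generalized Fibonacci number $U_n^{(k)}=\frac{1}{(\alpha-\beta)^k}(\alpha^{m+1}-\beta^{m+1})^{r}(\alpha^{m}-\beta^{m})^{k-r}$; equivalently $U_{mk+r}^{(k)}=U_m^{k-r}U_{m+1}^{r}$. *)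

(* Defs.v *)
From mathcomp Require Import all_boot all_order all_algebra.
Set Implicit Arguments.
Unset Strict Implicit.
Unset Printing Implicit Defensive.
Import Order.TTheory GRing.Theory Num.Theory.
Local Open Scope ring_scope.

Fixpoint lucasU (p q : int) (n : nat) : int :=
  match n with
  | 0%N => 0
  | n1.+1 => match n1 with
             | 0%N => 1
             | n2.+1 => p * lucasU p q n1 - q * lucasU p q n2
             end
  end.

Definition discr (p q : int) : int := p ^+ 2 - 4 * q.

(* The discriminant may be negative, so the two roots are taken in an
   arbitrary algebraically closed numeric field C, such as the complex
   numbers. *)
Definition lucas_alpha (C : numClosedFieldType) (p q : int) : C :=
  (p%:~R + sqrtC (discr p q)%:~R) / 2.

Definition lucas_beta (C : numClosedFieldType) (p q : int) : C :=
  (p%:~R - sqrtC (discr p q)%:~R) / 2.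

(* The generalized Fibonacci number U_n^(k), with n = m * k + r and r < k;
   meaningful for 0 < k and a nonzero discriminant. *)
Definition genfib (C : numClosedFieldType) (p q : int) (k n : nat) : C :=
  let a := lucas_alpha C p q in
  let b := lucas_beta C p q in
  let m := (n %/ k)%N in
  let r := (n %% k)%N in
  ((a - b) ^+ k)^-1 * (a ^+ m.+1 - b ^+ m.+1) ^+ r
    * (a ^+ m - b ^+ m) ^+ (k - r).

(* Main.v *)
Require Import Defs.
From mathcomp Require Import all_boot all_order all_algebra.
From mathcomp Require Import ring.
Import Order.TTheory GRing.Theory Num.Theory.
Local Open Scope ring_scope.

(** By Binet's formula [U^(k)_(m k + t) = U_m^(k - t) U_(m+1)^t], so (i) and (ii)
    are binomial expansions of [U_m (U_m + c U_(m+1))^(k - 1)] with [c = -1/p]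
    and [c = -p/q], where the recurrence collapses the inner sum to a multiple
    of [U_(m-1)], resp. [U_(m+2)]; (iii) is the geometric factorization of
    [U_m^k - (U_(m+1)/p)^k]. *)

Lemma lucasUSS (p q : int) (n : nat) :
  lucasU p q n.+2 = p * lucasU p q n.+1 - q * lucasU p q n.
Proof. by []. Qed.

Section Binet.
Variables (C : numClosedFieldType) (p q : int).
Local Notation a := (lucas_alpha C p q).
Local Notation b := (lucas_beta C p q).

Lemma lucas_alphaDbeta : a + b = p%:~R.
Proof. by rewrite /lucas_alpha /lucas_beta; field. Qed.

Lemma lucas_alphaBbeta : a - b = sqrtC (discr p q)%:~R.
Proof. by rewrite /lucas_alpha /lucas_beta; field. Qed.

Lemma lucas_alphaMbeta : a * b = q%:~R.
Proof.
have -> : a * b = (p%:~R ^+ 2 - sqrtC (discr p q)%:~R ^+ 2) / 4.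
  by rewrite /lucas_alpha /lucas_beta; field.
by rewrite sqrtCK /discr rmorphB rmorphXn rmorphM /=; field.
Qed.

Lemma lucas_binet (n : nat) : a ^+ n - b ^+ n = (a - b) * (lucasU p q n)%:~R.
Proof.
(* The recurrence has order two, so the induction carries two consecutive indices. *)
suff [] : a ^+ n - b ^+ n = (a - b) * (lucasU p q n)%:~R
  /\ a ^+ n.+1 - b ^+ n.+1 = (a - b) * (lucasU p q n.+1)%:~R by [].
elim: n => [|n [IH0 IH1]]; first by rewrite subrr mulr0 !expr1 mulr1.
split=> //; rewrite lucasUSS rmorphB !rmorphM /= mulrBr !(mulrCA (a - b)).
rewrite -IH0 -IH1 -lucas_alphaDbeta -lucas_alphaMbeta !exprS; ring.
Qed.

(** Binet's formula extracts one [a - b] from each of the [k] factors, cancelling the prefactor;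
    [a - b] is nonzero because its square is the discriminant. The bound on [t] makes [m] and [t]
    the quotient and remainder. *)
Lemma genfib_lucasU (k m t : nat) : discr p q != 0 -> (t < k)%N ->
  genfib C p q k (m * k + t)
    = (lucasU p q m)%:~R ^+ (k - t) * (lucasU p q m.+1)%:~R ^+ t.
Proof.
move=> hD ltk; have k0 : (0 < k)%N by apply: leq_ltn_trans ltk.
rewrite /genfib divnMDl // divn_small // addn0 modnMDl modn_small //.
have ab0 : a - b != 0 by rewrite lucas_alphaBbeta sqrtC_eq0 intr_eq0.
rewrite !lucas_binet !exprMn -[X in (a - b) ^+ X](subnK (ltnW ltk)) exprD.
by field; rewrite !expf_neq0.
Qed.

Lemma genfib_lucasUX (k m : nat) : discr p q != 0 -> (0 < k)%N ->
  genfib C p q k (m * k) = (lucasU p q m)%:~R ^+ k.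
Proof.
by move=> hD k0; rewrite -[(m * k)%N]addn0 genfib_lucasU // subn0 mulr1.
Qed.

End Binet.

(** As [t <= k], the exponent of [x] is always positive: one [x] factors out and leaves the binomial
    expansion. *)
Lemma sum_binomial_weighted (R : comPzRingType) (x y c : R) (k : nat) :
  \sum_(t < k.+1) 'C(k, t)%:R * c ^+ t * (x ^+ (k.+1 - t) * y ^+ t)
    = x * (x + c * y) ^+ k.
Proof.
rewrite exprDn mulr_sumr; apply: eq_bigr => t _.
by rewrite subSn ?leq_ord // exprS exprMn -mulr_natl; ring.
Qed.

(** Again one [x] factors out of each term. Keeping [x - c * y] as a multiplier avoids any
    division. *)
Lemma sum_geometric_weighted (R : comPzRingType) (x y c : R) (k : nat) :
  (x - c * y) * (\sum_(t < k) c ^+ t * (x ^+ (k - t) * y ^+ t))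
    = x * (x ^+ k - (c * y) ^+ k).
Proof.
rewrite subrXX mulrCA; congr (_ * _); rewrite mulr_sumr.
case: k => [|k]; first by rewrite !big_ord0.
apply: eq_bigr => t _.
by rewrite subSn ?leq_ord // exprS exprMn; ring.
Qed.

Theorem theorem2 (C : numClosedFieldType) (p q : int) (k m : nat)
    (hp : p != 0) (hq : q != 0) (hD : discr p q != 0)
    (hk : (2 <= k)%N) (hm : (1 <= m)%N) :
  let P : C := p%:~R in
  let Q : C := q%:~R in
  let U (n : nat) : C := (lucasU p q n)%:~R in
  let G (j n : nat) : C := genfib C p q j n in
  [/\ \sum_(t < k) 'C(k - 1, t)%:R * (- P) ^- t * G k (m * k + t)%N
        = (Q / P) ^+ (k - 1) * U m * G (k - 1)%N ((m - 1) * (k - 1))%N,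
      \sum_(t < k) 'C(k - 1, t)%:R * (- P / Q) ^+ t * G k (m * k + t)%N
        = (- Q) ^- (k - 1) * U m * G (k - 1)%N ((m + 2) * (k - 1))%N
    & lucasU p q (m - 1) != 0 ->
      \sum_(t < k) P ^- t * G k (m * k + t)%N
        = - (P / Q) * P ^- k * (U m / U (m - 1)%N)
            * (G k ((m + 1) * k)%N - P ^+ k * G k (m * k)%N)].
Proof.
move=> P Q U G.
have P0 : P != 0 by rewrite intr_eq0.
have Q0 : Q != 0 by rewrite intr_eq0.
have recU n : U n.+2 = P * U n.+1 - Q * U n.
  by rewrite /U lucasUSS rmorphB !rmorphM.
have GE (t : 'I_k) : G k (m * k + t)%N = U m ^+ (k - t) * U m.+1 ^+ t.
  exact: genfib_lucasU.
have GX j n : (0 < j)%N -> G j (n * j)%N = U n ^+ j by exact: genfib_lucasUX.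
(* From here on [k] and [m] denote the original values minus one, which removes the truncated
   subtractions. *)
case: k hk GE => [//|k]; rewrite ltnS => k0 GE.
case: m hm GE => [//|m] _ GE.
rewrite !subn1 /= addn2 addn1 !GX //; split.
- under eq_bigr => t _ do rewrite GE -exprVn.
  rewrite sum_binomial_weighted -mulrA mulrCA -exprMn; congr (_ * _ ^+ _).
  (* Equal exponents reduce the goal to the bases: [U m.+1 - U m.+2 / P = Q / P * U m]. *)
  by rewrite recU; field; rewrite ?oppr_eq0 P0.
- under eq_bigr => t _ do rewrite GE.
  rewrite sum_binomial_weighted -exprVn -mulrA mulrCA -exprMn.
  (* Here the recurrence is read one index higher: [U m.+1 - P / Q * U m.+2 = - U m.+3 / Q]. *)
  by congr (_ * _ ^+ _); rewrite [U m.+3]recU; field; rewrite ?oppr_eq0 Q0.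
- move=> hU; have U0 : U m != 0 by rewrite intr_eq0.
  under eq_bigr => t _ do rewrite GE -exprVn.
  have E : U m.+1 - P^-1 * U m.+2 = Q / P * U m by rewrite recU; field.
  have E0 : Q / P * U m != 0 by rewrite !mulf_neq0 ?invr_eq0.
  (* Multiplying by [Q / P * U m], nonzero by [hU], supplies the factor [x - c * y] with [c = P^-1]
     that telescopes the sum. *)
  apply: (mulfI E0); rewrite -{1}E sum_geometric_weighted exprMn exprVn.
  by field; rewrite U0 Q0 P0 expf_neq0.
Qed.
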